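(* Let $r\geq 1$ and $d\geq 2$ be integers and let $b:\mathbb{N}\to(0,\infty)$ be any function with $b(n)\to\infty$ as $n\to\infty$. For an $(r+1)$-uniform linear hypergraph $G$ with maximum degree $d$ on $n$ vertices, let $\mathcal{I}(G)$ be the independent set produced by the randomized greedy algorithm. Then $$\sup_G\ \mathbb{P}\Big[\big||\mathcal{I}(G)|-\mathbb{E}[|\mathcal{I}(G)|]\big|>\sqrt{n}\,b(n)\Big]\to 0\quad\text{as } n\to\infty,$$ where the supremum is over all $(r+1)$-uniform linear hypergraphs $G$ on $n$ vertices with maximum degree $d$.
   Context: A hypergraph is a pair $(V,E)$ with $V$ a finite set and $E$ a family of nonempty subsets of $V$; it is $(r+1)$-uniform if all edges have size $r+1$, and linear if any two distinct edges share at most one vertex. The degree of a vertex is the number of edges containing it. An independent set is a vertex subset containing no edge. The randomized greedy algorithm: maintain a set $S$ of selected vertices (initially empty) and a set $R$ of remaining vertices (initially $V$); while $R\neq\emptyset$, choose $v\in R$ uniformly at random, add $v$ to $S$, remove $v$ from $R$, and remove from $R$ every vertex $w$ for which some edge $e$ satisfies $e\subseteq S\cup\{w\}$. The output is $\mathcal{I}(G)=S$. *)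

(* Defs.v *)
From HB Require Import structures.
From mathcomp Require Import all_boot all_order all_algebra.

Set Implicit Arguments.
Unset Strict Implicit.
Unset Printing Implicit Defensive.

Import Order.TTheory GRing.Theory Num.Theory.
Local Open Scope ring_scope.

Record hypergraph (T : finType) := Hypergraph {
  edges : {set {set T}};
  edges_nonempty : forall e, e \in edges -> e != set0
}.

Definition uniform (T : finType) (k : nat) (G : hypergraph T) : Prop :=
  forall e, e \in edges G -> #|e| = k.

Definition linear_hypergraph (T : finType) (G : hypergraph T) : Prop :=
  forall e f, e \in edges G -> f \in edges G -> e != f -> (#|e :&: f| <= 1)%N.

Definition degree (T : finType) (G : hypergraph T) (v : T) : nat :=
  #|[set e in edges G | v \in e]|.

Definition max_degree (T : finType) (G : hypergraph T) : nat :=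
  (\max_(v : T) degree G v)%N.

Definition independent (T : finType) (G : hypergraph T) (S : {set T}) : Prop :=
  forall e, e \in edges G -> ~~ (e \subset S).

(* The remaining set after the step that selects [v]; [S] is the selected set
   before that step. *)
Definition remaining_after (T : finType) (G : hypergraph T)
    (S Rem : {set T}) (v : T) : {set T} :=
  [set w in Rem :\ v | ~~ [exists e in edges G, e \subset (v |: S) :|: [set w]]].

(* [greedy_from R G k S Rem] is the probability mass function of the output of
   the algorithm run for at most [k] steps from the state [(S, Rem)]. Each step
   removes a vertex from [Rem], so the bound is immaterial once [#|Rem| <= k];
   see [greedy_from_fuel]. *)
Fixpoint greedy_from (R : realFieldType) (T : finType) (G : hypergraph T)
    (k : nat) (S Rem : {set T}) : {set T} -> R :=
  fun I =>
    if Rem == set0 then (I == S)%:R else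
    if k is k'.+1 then
      #|Rem|%:R^-1 *
        \sum_(v in Rem) greedy_from R G k' (v |: S) (remaining_after G S Rem v) I
    else (I == S)%:R.

Definition greedy_law (R : realFieldType) (T : finType) (G : hypergraph T) :
    {set T} -> R :=
  greedy_from R G #|T| set0 [set: T].

(* Probability of the event [I(G) \in A], and expectation of [f (I(G))]. *)
Definition greedy_prob (R : realFieldType) (T : finType) (G : hypergraph T)
    (A : pred {set T}) : R :=
  \sum_(S : {set T} | A S) greedy_law R G S.

Definition greedy_mean (R : realFieldType) (T : finType) (G : hypergraph T)
    (f : {set T} -> R) : R :=
  \sum_(S : {set T}) greedy_law R G S * f S.

Section Facts.
Variables (R : realFieldType) (T : finType) (G : hypergraph T).
Implicit Types (S Rem I : {set T}).

Lemma remaining_after_card S Rem v :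
  v \in Rem -> (#|remaining_after G S Rem v| < #|Rem|)%N.
Proof.
move=> vR; rewrite (cardsD1 v Rem) vR add1n ltnS; apply: subset_leq_card.
by apply/subsetP => w; rewrite inE => /andP[].
Qed.

Lemma greedy_from_fuel k k' S Rem I :
  (#|Rem| <= k)%N -> (#|Rem| <= k')%N ->
  greedy_from R G k S Rem I = greedy_from R G k' S Rem I.
Proof.
elim: k k' S Rem => [|k IH] [|k'] S Rem //=.
- by rewrite leqn0 cards_eq0 => ->.
- by move=> _; rewrite leqn0 cards_eq0 => ->.
- case: eqP => // _ h h'; congr (_ * _); apply: eq_bigr => v vR.
  by apply: IH; rewrite -ltnS; apply: leq_trans (remaining_after_card S vR) _.
Qed.

Lemma greedy_from_ge0 k S Rem I : 0 <= greedy_from R G k S Rem I.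
Proof.
elim: k S Rem => [|k IH] S Rem /=; case: ifP => _; rewrite ?ler0n //.
by rewrite mulr_ge0 ?invr_ge0 ?ler0n // sumr_ge0.
Qed.

Lemma greedy_from_sum1 k S Rem : \sum_I greedy_from R G k S Rem I = 1.
Proof.
have dirac S0 : \sum_I (I == S0)%:R = 1 :> R.
  by rewrite (bigD1 S0) //= eqxx big1 ?addr0 // => I /negbTE ->.
elim: k S Rem => [|k IH] S Rem /=; case: eqP => // /eqP Rn0.
rewrite -mulr_sumr exchange_big /= (eq_bigr (fun=> 1)); last by move=> v _.
by rewrite sumr_const mulVf // pnatr_eq0 cards_eq0.
Qed.

Lemma greedy_law_ge0 I : 0 <= greedy_law R G I.
Proof. exact: greedy_from_ge0. Qed.

Lemma greedy_law_sum1 : \sum_I greedy_law R G I = 1.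
Proof. exact: greedy_from_sum1. Qed.

Lemma greedy_prob_ge0 (A : pred {set T}) : 0 <= greedy_prob R G A.
Proof. by apply: sumr_ge0 => I _; exact: greedy_law_ge0. Qed.

Lemma greedy_prob_le1 (A : pred {set T}) : greedy_prob R G A <= 1.
Proof.
rewrite -greedy_law_sum1 (bigID A) /= lerDl.
by apply: sumr_ge0 => I _; exact: greedy_law_ge0.
Qed.

Lemma greedy_from_independent k S Rem I :
  independent G S ->
  (forall v, v \in Rem -> independent G (v |: S)) ->
  greedy_from R G k S Rem I != 0 -> independent G I.
Proof.
have dirac S0 : independent G S0 -> (I == S0)%:R != 0 :> R -> independent G I.
  by move=> ind0; case: (I =P S0) => [-> //|_]; rewrite mulr0n eqxx.
elim: k S Rem => [|k IH] S Rem indS indR /=; case: ifP => _; try exact: dirac.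
rewrite mulf_eq0 negb_or => /andP[_].
have [/existsP[v /andP[vR ne0]] _|] :=
  boolP [exists v, (v \in Rem) &&
    (greedy_from R G k (v |: S) (remaining_after G S Rem v) I != 0)].
  apply: IH ne0 => [|w]; first exact: indR.
  rewrite inE => /andP[_ /existsPn h] e eG.
  by have := h e; rewrite eG /= setUC.
move/existsPn => h; rewrite big1 ?eqxx // => v vR.
by have := h v; rewrite vR /= negbK => /eqP.
Qed.

Lemma greedy_law_independent r I :
  (0 < r)%N -> uniform r.+1 G -> greedy_law R G I != 0 -> independent G I.
Proof.
move=> r0 unif; apply: greedy_from_independent => [|v _] e eG;
  apply/negP => /subset_leq_card; rewrite (unif e eG) ?cards0 //.
by rewrite setU0 cards1 ltnS leqNgt r0.
Qed.

End Facts.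

(* Main.v *)
(** Inspecting all vertices in a uniformly random order and skipping the blocked
    ones gives the same output law as the algorithm. Run two such processes
    along the same order from states that differ at one vertex [v]: a
    discrepancy at a vertex must come from an earlier discrepancy at one of its
    neighbours, so the expected final discrepancy is at most the expected number
    of increasing paths issued from [v], that is at most
    [\sum_j Delta ^ j / j! <= exp Delta], where [Delta = d (r + 1)] bounds the
    number of neighbours. Hence the conditional means of the output size form a
    martingale with increments bounded by [exp Delta], the variance of the size
    is at most [n exp(Delta) ^ 2], and Chebyshev's inequality gives the bound
    [(exp Delta / b n) ^ 2], uniformly in [G]. *)

Require Import Defs.
From mathcomp Require Import all_boot all_order all_algebra.
From mathcomp Require Import ring.

Set Implicit Arguments.
Unset Strict Implicit.
Unset Printing Implicit Defensive.

Import Order.TTheory GRing.Theory Num.Theory.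
Local Open Scope ring_scope.

Lemma exchange_big_setD1 (V : nmodType) (T : finType) (U : {set T})
    (P : pred T) (F : T -> T -> V) :
  \sum_(v in U) \sum_(w in U :\ v | P w) F v w =
  \sum_(w in U | P w) \sum_(v in U :\ w) F v w.
Proof.
rewrite (exchange_big_dep (fun w => (w \in U) && P w)) /=; last first.
  by move=> v w vU /andP[/setD1P[_ ->] ->].
apply: eq_bigr => w /andP[wU Pw]; apply: eq_bigl => v.
by rewrite !inE wU Pw eq_sym !andbT andbC.
Qed.

(** * Counting paths in the adjacency graph *)

Section Paths.
Variables (T : finType) (G : hypergraph T).
Implicit Types (x v w : T) (U : {set T}).

Definition adjacent x w := [exists e in edges G, (x \in e) && (w \in e)].

(* The number of paths of length [j] issued from [x] with distinct further
   vertices in [U]. *)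
Fixpoint npaths j x U : nat :=
  if j is j'.+1 then (\sum_(v in U | adjacent x v) npaths j' v (U :\ v))%N
  else 1%N.

(** Deleting [v] keeps exactly the paths that avoid [v], so a path with [j] distinct further
    vertices survives [#|U| - j] deletions; the additive form avoids truncated subtraction. *)
Lemma sum_npaths_setD1 j x U :
  (\sum_(v in U) npaths j x (U :\ v) + j * npaths j x U = #|U| * npaths j x U)%N.
Proof.
elim: j x U => [|j IH] x U /=.
  by rewrite sum_nat_const mul0n addn0.
rewrite (exchange_big_setD1 U (adjacent x)
  (fun v w => npaths j w ((U :\ v) :\ w))) /=.
rewrite !big_distrr /= -big_split /=; apply: eq_bigr => w /andP[wU _].
have -> : (\sum_(v in U :\ w) npaths j w (U :\ v :\ w) =
           \sum_(v in U :\ w) npaths j w (U :\ w :\ v))%N.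
  by apply: eq_bigr => v _; congr npaths; apply/setP => y; rewrite !inE andbCA.
by rewrite mulSn addnCA IH (cardsD1 w U) wU mulnDl mul1n.
Qed.

(** Union bound over the edges through [x], each counted with all its vertices, [x] included. *)
Lemma card_adjacent k x :
  uniform k G -> (#|[set w | adjacent x w]| <= max_degree G * k)%N.
Proof.
move=> unif; pose Ex := [set e in edges G | x \in e].
have sub : [set w | adjacent x w] \subset \bigcup_(e in Ex) e.
  apply/subsetP => w; rewrite inE => /existsP[e /and3P[eG xe we]].
  by apply/bigcupP; exists e => //; rewrite inE eG.
apply: leq_trans (subset_leq_card sub) _.
have: (#|\bigcup_(e in Ex) e| <= \sum_(e in Ex) #|e|)%N.
  elim/big_rec2: _ => [|e m A _ le]; first by rewrite cards0.
  by apply: leq_trans (leq_card_setU _ _) _; rewrite leq_add2l.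
move/leq_trans; apply.
rewrite (eq_bigr (fun=> k)) => [|e]; last by rewrite inE => /andP[/unif].
by rewrite sum_nat_const leq_mul2r (leq_bigmax (F := degree G) x) orbT.
Qed.

Lemma npaths_le (D : nat) j x U :
  (forall y, #|[set w | adjacent y w]| <= D)%N -> (npaths j x U <= D ^ j)%N.
Proof.
move=> hD; elim: j x U => [|j IH] x U //=.
apply: (@leq_trans (\sum_(v in U | adjacent x v) D ^ j)%N).
  by apply: leq_sum => v _; exact: IH.
rewrite sum_nat_const expnS leq_mul2r; apply/orP; right.
apply: leq_trans (hD x); apply: subset_leq_card; apply/subsetP => w.
by rewrite !inE => /andP[].
Qed.

End Paths.

(** * Expected number of increasing paths *)

Section Influence.
Variables (R : realFieldType) (T : finType) (G : hypergraph T).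
Implicit Types (x v w : T) (U : {set T}).

(* In a uniformly random order of [U] a given path of length [j] is increasing
   with probability [1 / j!], so this is an expected number of increasing
   paths. *)
Definition influence k x U : R := \sum_(j < k.+1) (npaths G j x U)%:R / (j`!)%:R.

Lemma influence_ge0 k x U : 0 <= influence k x U.
Proof. by apply: sumr_ge0 => j _; rewrite divr_ge0 ?ler0n. Qed.

(** Condition on the first vertex [w] of the order: an increasing path from [x] either avoids [w],
    or steps to [w] first and continues as an increasing path from [w]. *)
Lemma influence_rec k x U : #|U| = k.+1 ->
  \sum_(w in U) (influence k x (U :\ w) +
                 (adjacent G x w)%:R * influence k w (U :\ w)) =
  k.+1%:R * influence k.+1 x U.
Proof.
move=> cU; rewrite big_split /= /influence.
rewrite exchange_big /=.
under eq_bigr => j _ do rewrite -mulr_suml -natr_sum.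
have -> : \sum_(w in U) (adjacent G x w)%:R *
             \sum_(j < k.+1) (npaths G j w (U :\ w))%:R / (j`!)%:R =
          \sum_(j < k.+1) (npaths G j.+1 x U)%:R / (j`!)%:R :> R.
  under eq_bigr => w _ do rewrite mulr_sumr.
  rewrite exchange_big /=; apply: eq_bigr => j _.
  rewrite natr_sum mulr_suml [RHS]big_mkcondr /=; apply: eq_bigr => w _.
  by case: ifP => _; rewrite ?mul1r ?mul0r.
(* Index shift by [1 / j! = (j + 1) / (j + 1)!]; the new term at [0] vanishes. *)
have -> : \sum_(j < k.+1) (npaths G j.+1 x U)%:R / (j`!)%:R =
   \sum_(j < k.+2) j%:R * ((npaths G j x U)%:R / (j`!)%:R) :> R.
  rewrite [RHS]big_ord_recl mul0r add0r; apply: eq_bigr => j _.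
  rewrite lift0 factS natrM invfM mulrCA; congr (_ * _).
  by rewrite mulrA divff ?mul1r // pnatr_eq0.
(* The added term at [k.+1] has coefficient zero; the coefficients [k.+1 - j] and [j] then add up to
   [k.+1]. *)
have -> : \sum_(j < k.+1) (\sum_(w in U) npaths G j x (U :\ w))%:R / (j`!)%:R =
   \sum_(j < k.+2) (k.+1%:R - j%:R) * ((npaths G j x U)%:R / (j`!)%:R) :> R.
  rewrite [RHS]big_ord_recr /= subrr mul0r addr0; apply: eq_bigr => j _.
  rewrite mulrA; congr (_ / _); rewrite mulrBl -!natrM.
  by have := sum_npaths_setD1 G j x U; rewrite cU => <-; rewrite natrD addrK.
by rewrite -big_split mulr_sumr; apply: eq_bigr => j _; rewrite /= -mulrDl subrK.
Qed.

Lemma influence_le (D : nat) k x U :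
  (forall y, #|[set w | adjacent G y w]| <= D)%N ->
  influence k x U <= \sum_(j < k.+1) D%:R ^+ j / (j`!)%:R.
Proof.
move=> hD; apply: ler_sum => j _; rewrite ler_pM2r ?invr_gt0 ?ltr0n ?fact_gt0 //.
by rewrite -natrX ler_nat npaths_le.
Qed.

End Influence.

(** * The process in random order *)

Section LazyGreedy.
Variables (R : realFieldType) (T : finType) (G : hypergraph T).
Implicit Types (x v w : T) (A D S U : {set T}) (F : {set T} -> R).

(** Requiring [w \in e] makes the test local to the neighbours of [w] for arbitrary [S]; for
    independent [S] it is the test of the algorithm ([blockedE]). *)
Definition blocked S w := [exists e in edges G, (w \in e) && (e :\ w \subset S)].

Definition lazy_step A S w :=
  if (w \notin A) && ~~ blocked S w then w |: S else S.

(* The mean of [F] at the output of the process that inspects the vertices of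
   [U] in a uniformly random order, and rejects those of [A] on sight. *)
Fixpoint lazy_mean A k S U F : R :=
  if k is k'.+1 then
    #|U|%:R^-1 * \sum_(v in U) lazy_mean A k' (lazy_step A S v) (U :\ v) F
  else F S.

Lemma card_setD1_pred k U v : #|U| = k.+1 -> v \in U -> #|U :\ v| = k.
Proof. by move=> cU vU; move: cU; rewrite (cardsD1 v) vU => -[]. Qed.

Lemma lazy_mean_setU1_notin A k S U F v : v \notin U ->
  lazy_mean (v |: A) k S U F = lazy_mean A k S U F.
Proof.
elim: k S U => [|k IH] S U vU //=; congr (_ * _); apply: eq_bigr => w wU.
rewrite IH; last by rewrite !inE negb_and vU orbT.
rewrite /lazy_step !inE; case: eqP => // wv.
by rewrite -wv wU in vU.
Qed.

Lemma lazy_meanS A k S U F :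
  lazy_mean A k.+1 S U F =
  #|U|%:R^-1 * \sum_(v in U) lazy_mean A k (lazy_step A S v) (U :\ v) F.
Proof. by []. Qed.

(** A vertex rejected on sight never alters the state, and the order induced on the others stays
    uniform. This lets two processes with different vertices left run over the same [U]. *)
Lemma lazy_mean_setU1_in A k S U F v : #|U| = k.+1 -> v \in U ->
  lazy_mean (v |: A) k.+1 S U F = lazy_mean A k S (U :\ v) F.
Proof.
elim: k S U => [|k IH] S U cU vU; have cUv := card_setD1_pred cU vU;
  rewrite lazy_meanS (big_setD1 v) //=;
  have -> : lazy_step (v |: A) S v = S by rewrite /lazy_step !inE eqxx.
  rewrite cU invr1 mul1r big1 ?addr0 // => w; move/eqP: cUv.
  by rewrite cards_eq0 => /eqP ->; rewrite inE.
pose t := \sum_(w in U :\ v) lazy_mean A k (lazy_step A S w) (U :\ v :\ w) F.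
rewrite -!lazy_meanS lazy_mean_setU1_notin ?lazy_meanS; last by rewrite !inE eqxx.
rewrite (eq_bigr (fun w => lazy_mean A k (lazy_step A S w) (U :\ v :\ w) F));
  last first.
  move=> w wUv; have /setD1P[wv wU] := wUv.
  have -> : lazy_step (v |: A) S w = lazy_step A S w.
    by rewrite /lazy_step !inE (negbTE wv).
  rewrite -lazy_meanS IH ?(card_setD1_pred cU) // ?inE ?vU ?andbT 1?eq_sym //.
  by congr lazy_mean; apply/setP => y; rewrite !inE andbCA.
(* What remains is [(t / (k + 1) + t) / (k + 2) = t / (k + 1)], the first summand being the case
   where [v] is inspected first. *)
rewrite -/t cU cUv -[k.+2%:R]natr1; field.
by rewrite !(nat1r, natr1) !pnatr_eq0.
Qed.

(** * Coupling and variance *)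

Lemma blocked_local D S1 S2 w :
  (forall x, x \notin D -> (x \in S1) = (x \in S2)) ->
  ~~ [exists x in D, adjacent G x w] -> blocked S1 w -> blocked S2 w.
Proof.
move=> agree nadj /existsP[e /and3P[eG we eS]].
apply/existsP; exists e; rewrite eG we /=; apply/subsetP => x xe.
rewrite -agree; first exact: (subsetP eS).
apply: contra nadj => xD; apply/existsP; exists x; rewrite xD /=.
by apply/existsP; exists e; rewrite eG we; case/setD1P: xe => _ ->.
Qed.

(** Without a neighbour of [w] in [D], both processes see the same blocking edges, so they can
    decide differently on [w] only if [w] is in [D] already. *)
Lemma lazy_step_agree A1 A2 D S1 S2 w :
  (forall x, x \notin D -> (x \in A1) = (x \in A2)) ->
  (forall x, x \notin D -> (x \in S1) = (x \in S2)) ->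
  forall x, x \notin (if [exists x in D, adjacent G x w] then w |: D else D) ->
    (x \in lazy_step A1 S1 w) = (x \in lazy_step A2 S2 w).
Proof.
move=> agA agS x; case: ifPn => [_|nadj].
  rewrite !inE negb_or => /andP[xw xD].
  by rewrite /lazy_step; do 2!case: ifP => _; rewrite ?inE ?(negbTE xw) /= agS.
move=> xD; have [xw|xw] := eqVneq x w; last first.
  by rewrite /lazy_step; do 2!case: ifP => _; rewrite ?inE ?(negbTE xw) /= agS.
have eqb : blocked S1 w = blocked S2 w.
  by apply/idP/idP; apply: (@blocked_local D) => // y yD; rewrite agS.
rewrite /lazy_step eqb -xw (agA _ xD); case: ifP => _; first by rewrite !inE eqxx.
exact: agS.
Qed.

Lemma card_agree D S1 S2 :
  (forall x, x \notin D -> (x \in S1) = (x \in S2)) -> (#|S1| <= #|S2| + #|D|)%N.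
Proof.
move=> ag; apply: leq_trans (leq_card_setU _ _).
apply: subset_leq_card; apply/subsetP => x xS; rewrite inE.
by have [|xD] := boolP (x \in D); rewrite ?orbT // -ag ?xS.
Qed.

(* Run both processes along the same random order: a discrepancy can only
   spread from a vertex to a later neighbour. *)
Lemma lazy_mean_card_coupling A1 A2 D k S1 S2 U : #|U| = k ->
  (forall x, x \notin D -> (x \in A1) = (x \in A2)) ->
  (forall x, x \notin D -> (x \in S1) = (x \in S2)) ->
  `|lazy_mean A1 k S1 U (fun S => #|S|%:R) - lazy_mean A2 k S2 U (fun S => #|S|%:R)|
     <= \sum_(x in D) influence R G k x U.
Proof.
elim: k D S1 S2 U => [|k IH] D S1 S2 U cU agA agS.
  (* With nothing left to inspect, each discrepancy counts one empty path. *)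
  rewrite (eq_bigr (fun=> 1)) => [|x _]; last first.
    by rewrite /influence big_ord_recl big_ord0 /= divr1 addr0.
  rewrite sumr_const /= ler_distl lerBlDr -!natrD !ler_nat.
  by rewrite !card_agree // => x xD; rewrite agS.
rewrite /= cU -mulrBr -sumrB normrM ger0_norm ?invr_ge0 ?ler0n //.
rewrite ler_pdivrMl ?ltr0n // mulr_sumr.
under [leRHS]eq_bigr => x _ do rewrite -influence_rec //.
rewrite exchange_big /=.
apply: le_trans (ler_norm_sum _ _ _) _; apply: ler_sum => w wU.
pose D' := if [exists x in D, adjacent G x w] then w |: D else D.
have DD' x : x \notin D' -> x \notin D.
  by rewrite /D'; case: ifP => _ //; rewrite !inE negb_or => /andP[].
apply: le_trans (IH D' _ _ _ (card_setD1_pred cU wU) _ _) _.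
- by move=> x /DD'; exact: agA.
- exact: lazy_step_agree.
rewrite big_split /= /D'; case: ifPn => [/existsP[y /andP[yD yw]]|_]; last first.
  rewrite lerDl; apply: sumr_ge0 => x _.
  by rewrite mulr_ge0 ?ler0n ?influence_ge0.
(* [D] may meet [U], so [w] can be a discrepancy already. *)
have [wD|wD] := boolP (w \in D).
  rewrite (setUidPr _) ?sub1set // lerDl; apply: sumr_ge0 => x _.
  by rewrite mulr_ge0 ?ler0n ?influence_ge0.
(* The influence of the new discrepancy [w] is charged to one neighbour [y] in [D]. *)
rewrite big_setU1 //= addrC lerD2l (bigD1 y) //= yw mul1r lerDl.
by apply: sumr_ge0 => x _; rewrite mulr_ge0 ?ler0n ?influence_ge0.
Qed.

(** Once [v] is put back into [U] as rejected on sight, the two processes differ at [v] only. *)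
Lemma lazy_mean_card_step k S U v : #|U| = k.+1 -> v \in U ->
  `|lazy_mean set0 k (lazy_step set0 S v) (U :\ v) (fun S => #|S|%:R)
    - lazy_mean set0 k.+1 S U (fun S => #|S|%:R)| <= influence R G k.+1 v U.
Proof.
move=> cU vU; rewrite -lazy_mean_setU1_in //.
rewrite (_ : influence _ _ _ _ _ = \sum_(x in [set v]) influence R G k.+1 x U);
  last by rewrite big_set1.
apply: lazy_mean_card_coupling => // x; rewrite !inE => /negbTE xv.
  by rewrite xv.
by rewrite /lazy_step; case: ifP; rewrite ?inE ?xv.
Qed.

(* The conditional means along the process form a martingale whose increments
   are bounded by [C]. *)
Lemma lazy_variance_le C k S U : #|U| = k ->
  (forall j x W, (j <= k)%N -> influence R G j x W <= C) ->
  lazy_mean set0 k S U (fun S => #|S|%:R ^+ 2)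
    - lazy_mean set0 k S U (fun S => #|S|%:R) ^+ 2 <= k%:R * C ^+ 2.
Proof.
move=> cU; elim: k S U cU => [|k IH] S U cU hC; first by rewrite subrr mul0r.
set g := lazy_mean set0 k.+1 S U (fun S => #|S|%:R).
pose gv v := lazy_mean set0 k (lazy_step set0 S v) (U :\ v) (fun S => #|S|%:R).
have gE : \sum_(v in U) gv v = k.+1%:R * g.
  by rewrite /g lazy_meanS cU mulVKf ?pnatr_eq0.
have sq v : v \in U -> (gv v - g) ^+ 2 <= C ^+ 2.
  move=> vU; rewrite -real_normK ?num_real //.
  have le : `|gv v - g| <= C.
    exact: le_trans (lazy_mean_card_step S cU vU) (hC _ _ _ (leqnn _)).
  by rewrite lerXn2r ?nnegrE // (le_trans _ le).
rewrite [X in X - _]/= cU lerBlDr ler_pdivrMl ?ltr0n //.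
(* Bound [gv v ^+ 2] by [C ^+ 2 + 2 * g * gv v - g ^+ 2]; averaging over [v] with [gE] leaves
   [C ^+ 2 + g ^+ 2]. *)
apply: (@le_trans _ _
  (\sum_(v in U) (k.+1%:R * C ^+ 2 + 2 * g * gv v - g ^+ 2))); last first.
  rewrite sumrB big_split /= !sumr_const -mulr_sumr gE /= cU.
  rewrite -(mulr_natl (k.+1%:R * C ^+ 2)) -(mulr_natl (g ^+ 2)).
  by rewrite le_eqVlt; apply/orP; left; apply/eqP; ring.
apply: ler_sum => v vU.
have := IH (lazy_step set0 S v) _ (card_setD1_pred cU vU)
  (fun j x W le => hC j x W (leqW le)).
rewrite -/(gv v); set X := lazy_mean _ _ _ _ _ => h.
rewrite -subr_ge0 (_ : _ - X = (k%:R * C ^+ 2 - (X - gv v ^+ 2)) +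
                              (C ^+ 2 - (gv v - g) ^+ 2)).
  by rewrite addr_ge0 // subr_ge0 // sq.
by rewrite -natr1; ring.
Qed.

(** * Equivalence with the greedy algorithm *)

Lemma blockedE S w : independent G S ->
  blocked S w = [exists e in edges G, e \subset S :|: [set w]].
Proof.
move=> indS; apply/existsP/existsP => -[e].
  move=> /and3P[eG we eS]; exists e; rewrite eG /=; apply/subsetP => x xe.
  rewrite !inE; have [//|xw] := eqVneq x w; rewrite ?orbT // orbF.
  by apply: (subsetP eS); rewrite !inE xw.
move=> /andP[eG eS]; exists e; rewrite eG /=.
have sub : e :\ w \subset S by rewrite subDset setUC.
rewrite sub andbT; apply/negPn/negP => we; case/negP: (indS e eG).
apply: subset_trans sub; apply/subsetP => x xe; rewrite !inE xe andbT.
by apply: contraNneq we => <-.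
Qed.

Lemma independent_setU1 S v :
  independent G S -> ~~ blocked S v -> independent G (v |: S).
Proof.
move=> indS; rewrite blockedE // => /existsPn h e eG.
by have := h e; rewrite eG setUC.
Qed.

Lemma blocked_subset S S' w : S \subset S' -> blocked S w -> blocked S' w.
Proof.
move=> sub /existsP[e /and3P[eG we eS]]; apply/existsP; exists e.
by rewrite eG we (subset_trans eS).
Qed.

(** Blocking is monotone in [S], so the algorithm's remaining set is always the set of uninspected
    unblocked vertices. *)
Lemma remaining_after_unblocked S U v :
  independent G S -> ~~ blocked S v ->
  remaining_after G S [set w in U | ~~ blocked S w] v =
  [set w in U :\ v | ~~ blocked (v |: S) w].
Proof.
move=> indS vS; apply/setP => w; rewrite !inE.
rewrite -blockedE; last exact: independent_setU1.
have [bl|nbl] := boolP (blocked (v |: S) w); first by rewrite !andbF.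
have nS : ~~ blocked S w by apply: contra nbl; apply/blocked_subset/subsetUr.
by rewrite nS !andbT.
Qed.

Lemma lazy_mean_all_blocked A k S U F :
  #|U| = k -> (forall w, w \in U -> blocked S w) -> lazy_mean A k S U F = F S.
Proof.
elim: k U => [|k IH] U cU bl //=; rewrite (eq_bigr (fun=> F S)) => [|v vU].
  by rewrite sumr_const -(mulr_natl (F S)) cU mulKf ?pnatr_eq0.
rewrite /lazy_step bl // andbF; apply: IH; first exact: card_setD1_pred cU vU.
by move=> w /setD1P[_]; exact: bl.
Qed.

(* A rejected vertex leaves the state unchanged, so conditioning on the next
   accepted vertex makes it uniform among the remaining ones. *)
Lemma greedy_from_lazy_mean k S U I : independent G S -> (#|U| <= k)%N ->
  greedy_from R G k S [set w in U | ~~ blocked S w] I =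
  lazy_mean set0 #|U| S U (fun S' => (I == S')%:R).
Proof.
move: {2}#|U| (erefl #|U|) => m cU; rewrite cU.
elim: m k S U cU => [|m IH] k S U cU indS mk.
  have /eqP -> : U == set0 by rewrite -cards_eq0 cU.
  have -> : [set w in set0 | ~~ blocked S w] = set0.
    by apply/setP => w; rewrite !inE.
  by case: k {mk} => [|k] /=; rewrite eqxx.
case: k mk => // k mk.
set Rem := [set w in U | ~~ blocked S w].
have [Rem0|RemN0] := eqVneq Rem set0.
  rewrite Rem0 /= eqxx -[RHS]/(lazy_mean set0 m.+1 S U (fun S' => (I == S')%:R)).
  rewrite lazy_mean_all_blocked // => w wU; apply: contraT => wS.
  by have := in_set0 w; rewrite -Rem0 inE wU wS.
set g := greedy_from R G k.+1 S Rem I.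
have RemE : \sum_(v in Rem)
    greedy_from R G k (v |: S) (remaining_after G S Rem v) I = #|Rem|%:R * g.
  by rewrite /g /= (negbTE RemN0) mulrA divff ?mul1r // pnatr_eq0 cards_eq0.
(* Each blocked vertex contributes [g], using no fuel; the unblocked ones contribute [#|Rem|%:R * g]
   in total. *)
rewrite /= (bigID (fun v => blocked S v)) /=.
rewrite (eq_bigr (fun=> g)) => [|v /andP[vU vS]]; last first.
  rewrite /lazy_step vS andbF -(IH k.+1) ?(card_setD1_pred cU) // ?(ltnW mk) //.
  congr greedy_from; apply/setP => w; rewrite !inE.
  by have [->|] := eqVneq w v; rewrite ?vS ?andbF.
rewrite [X in _ + X](_ : _ = #|Rem|%:R * g); last first.
  rewrite -RemE; apply: eq_big => [v|v /andP[vU vS]]; first by rewrite inE.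
  rewrite /lazy_step inE vS /= -(IH k) ?(card_setD1_pred cU) //.
    by rewrite remaining_after_unblocked.
  exact: independent_setU1.
rewrite sumr_const -(mulr_natl g) -mulrDl -natrD.
have -> : (#|[pred v in U | blocked S v]| + #|Rem| = #|U|)%N.
  rewrite -[RHS](cardsID [set v | blocked S v]); congr addn.
    by apply: eq_card => v; rewrite !inE.
  by apply: eq_card => v; rewrite !inE andbC.
by rewrite mulrA mulVf ?mul1r // cU pnatr_eq0.
Qed.

Lemma lazy_mean_sum A k S U F :
  \sum_I lazy_mean A k S U (fun S' => (I == S')%:R) * F I = lazy_mean A k S U F.
Proof.
elim: k S U => [|k IH] S U /=.
  rewrite (bigD1 S) //= eqxx mul1r big1 ?addr0 // => I /negbTE ->.
  by rewrite mul0r.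
under eq_bigr => I _ do rewrite -mulrA mulr_suml.
rewrite -mulr_sumr exchange_big /=; congr (_ * _).
by apply: eq_bigr => v _; rewrite IH.
Qed.

Lemma greedy_mean_lazy_mean r F : (0 < r)%N -> uniform r.+1 G ->
  greedy_mean G F = lazy_mean set0 #|T| set0 setT F.
Proof.
move=> r0 unif; rewrite -lazy_mean_sum; apply: eq_bigr => I _; congr (_ * _).
have ind0 : independent G set0.
  by move=> e /edges_nonempty; apply: contra; rewrite subset0.
rewrite /greedy_law -[X in lazy_mean _ X]cardsT -(greedy_from_lazy_mean (k := #|T|)) //.
  (* Nothing is blocked initially: every edge has at least two vertices. *)
  congr greedy_from; apply/setP => w; rewrite !inE blockedE // set0U.
  apply/esym/existsPn => e; apply/negP => /andP[eG /subset_leq_card].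
  by rewrite (unif e eG) cards1 ltnS leqNgt r0.
by rewrite cardsT.
Qed.

End LazyGreedy.

(** * Variance bound and Chebyshev's inequality *)

Lemma greedy_variance_le (R : realFieldType) (T : finType) (G : hypergraph T)
    (r : nat) (C : R) : (0 < r)%N -> uniform r.+1 G ->
  (forall j x U, influence R G j x U <= C) ->
  greedy_mean G (fun S => (#|S|%:R - greedy_mean G (fun S' => #|S'|%:R)) ^+ 2)
    <= #|T|%:R * C ^+ 2.
Proof.
move=> r0 unif hC; set mu := greedy_mean G (fun S' => #|S'|%:R).
have -> : greedy_mean G (fun S => (#|S|%:R - mu) ^+ 2) =
          greedy_mean G (fun S => #|S|%:R ^+ 2) - mu ^+ 2.
  transitivity (\sum_S (greedy_law R G S * #|S|%:R ^+ 2
      - 2 * mu * (greedy_law R G S * #|S|%:R) + greedy_law R G S * mu ^+ 2)).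
    by apply: eq_bigr => S _; ring.
  rewrite big_split sumrB /= -mulr_suml greedy_law_sum1.
  rewrite -[X in _ - X + _]mulr_sumr -!/(greedy_mean _ _) -/mu; ring.
rewrite {}/mu !(greedy_mean_lazy_mean _ r0 unif).
by apply: lazy_variance_le => [|j x W _]; rewrite ?cardsT.
Qed.

Lemma greedy_chebyshev (R : realFieldType) (T : finType) (G : hypergraph T)
    (f : {set T} -> R) (m t : R) : 0 <= t ->
  t ^+ 2 * greedy_prob R G (fun S => t < `|f S - m|) <=
  greedy_mean G (fun S => (f S - m) ^+ 2).
Proof.
move=> t0; rewrite /greedy_prob mulr_sumr big_mkcond /=.
apply: ler_sum => S _; rewrite mulrC.
case: ifP => [/ltW le|_]; last by rewrite mulr_ge0 ?greedy_law_ge0 ?sqr_ge0.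
rewrite ler_wpM2l ?greedy_law_ge0 // -[leRHS]real_normK ?num_real //.
by rewrite lerXn2r ?nnegrE.
Qed.

(* Passage to the limit *)
From mathcomp Require Import all_classical all_reals all_analysis.

Import numFieldNormedType.Exports.
Local Open Scope classical_set_scope.

Lemma exp_sum_le_expR (R : realType) (x : R) (k : nat) : 0 <= x ->
  \sum_(j < k) x ^+ j / (j`!)%:R <= expR x.
Proof.
move=> x0.
have := @nondecreasing_cvgn_le _ (series (exp_coeff x)) _ (is_cvg_series_exp_coeff x) k.
rewrite /series /= big_mkord; apply.
by apply: nondecreasing_series => n _ _; exact: exp_coeff_ge0.
Qed.

(** The empty set is included, with [sup] equal to [0], for those [n] that admit no such
    hypergraph. *)
Lemma sup_le_of_bound (R : realType) (E : set R) (c : R) : 0 <= c ->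
  (forall p, E p -> 0 <= p <= c) -> 0 <= sup E <= c.
Proof.
move=> c0 hE; have [->|/set0P E0] := eqVneq E set0.
  by rewrite sup0 lexx c0.
have ubE : ubound E c by move=> p /hE /andP[].
rewrite ge_sup // andbT; case: (E0) => p Ep.
have /andP[p0 _] := hE p Ep; apply: le_trans p0 _.
by apply: ub_le_sup Ep; exists c.
Qed.

Theorem theorem5 (R : realType) (r d : nat) (hr : (1 <= r)%N) (hd : (2 <= d)%N)
    (b : nat -> R) (hb_pos : forall n : nat, 0 < b n)
    (hb_lim : b n @[n --> \oo] --> +oo) :
  sup [set p : R | exists (T : finType) (G : hypergraph T),
         [/\ #|T| = n, uniform r.+1 G, linear_hypergraph G, max_degree G = d &
             p = greedy_prob R G (fun S : {set T} =>
                   Num.sqrt n%:R * b n <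
                   `| #|S|%:R - greedy_mean G (fun S' : {set T} => #|S'|%:R) |)]]
    @[n --> \oo] --> (0 : R).
Proof.
pose C : R := expR (d * r.+1)%:R.
(* The upper function is [n C^2 / (sqrt n * b n)^2] with [n] cancelled. *)
apply: (@squeeze_cvgr _ _ _ _ (fun=> 0) (fun n => C ^+ 2 * (b n)^-1 ^+ 2)).
- near=> n; apply: sup_le_of_bound; first by rewrite mulr_ge0 ?sqr_ge0.
  move=> p [T [G [cT unif _ maxd ->]]]; rewrite greedy_prob_ge0 /=.
  have n0 : 0 < n%:R :> R by rewrite ltr0n; near: n; exact: nbhs_infty_gt.
  have hC j x U : influence R G j x U <= C.
    apply: le_trans (influence_le R (D := d * r.+1) j x U _) _.
      by move=> y; rewrite -maxd; exact: card_adjacent.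
    exact: exp_sum_le_expR.
  have t0 : 0 <= Num.sqrt n%:R * b n by rewrite mulr_ge0 ?sqrtr_ge0 // ltW.
  have := le_trans (greedy_chebyshev G (fun S => #|S|%:R) _ t0)
     (greedy_variance_le hr unif hC).
  rewrite cT exprMn sqr_sqrtr ?ler0n // -mulrA ler_pM2l //.
  by rewrite exprVn ler_pdivlMr ?exprn_gt0 // mulrC.
- exact: cvg_cst.
- have binv : (b n)^-1 @[n --> \oo] --> (0 : R).
    by apply/gtr0_cvgV0 => //; exact: nearW.
  rewrite -[X in _ --> X](_ : C ^+ 2 * (0 * 0) = 0); last by rewrite !mulr0.
  apply: cvgMr; apply: cvgM; exact: binv.
Unshelve. all: by end_near.
Qed.
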